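(* Let $(\Omega, \mathcal{A})$ be a measurable space, let $P$ and $Q$ be probability measures defined on $(\Omega, \mathcal{A})$ such that $P \ll Q$, let $X:\Omega\to\mathbb{R}$ be integrable both with respect to $P$ and with respect to $Q$, and let the real valued function $\phi$ be convex in some (not necessarily bounded) interval containing the range of $X$. Then $$ \int_{\Omega} \phi (X)\, d P - \phi \left(\int_{\Omega} X\, d P\right) \le \left\|\frac{d P}{d Q}\right\|_\infty \left(\int_{\Omega} \phi (X)\, d Q - \phi \left(\int_{\Omega} X\, d Q\right)\right). \qquad ( * ) $$ Moreover, suppose that $P\ne Q$. Then the following equality conditions hold. 1) Both sides of $( * )$ take the value $\infty$ if and only if $\int_{\Omega} \phi (X)\, d P = \infty$, and then either $\int_{\Omega} \phi (X)\, d Q = \infty$ or $\left\|\frac{dP}{d Q}\right\|_\infty = \infty$. Next, assume in addition that $\phi$ is strictly convex, and let $A:= \left\{\omega\in \Omega: \frac{d P}{d Q}(\omega) = \left\|\frac{d P}{d Q}\right\|_\infty\right\}$. 2) Both sides of $( * )$ take the value $0$ if and only if $X$ is $Q$-a.e. constant. 3) Both sides of $( * )$ take the same value $a$, with $0 < a < \infty$, if and only if the following three conditions hold: a) $\int_{\Omega} \phi (X)\, d Q < \infty$ and $\left\|\frac{d P}{d Q}\right\|_\infty < \infty$. b) There exists a constant $c$ such that $X \equiv c$ $Q$-a.e. on $\Omega\setminus A$, but $X$ is not $Q$-a.e. constant on $\Omega$. c) $Q (A) > 0$, $P (A) > 0$, and, with $c$ the constant from b), $$c = \int_{\Omega} X\,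 d Q = \frac{1}{ Q (A)} \int_{A} X\, d Q =\int_{\Omega} X\, d P = \frac{1}{ P (A)} \int_{A} X\, d P.$$
   Context: $P\ll Q$ means that $P$ is absolutely continuous with respect to $Q$; $\frac{dP}{dQ}$ denotes the Radon-Nikodym derivative, for which a fixed representative with $0\le \frac{dP}{dQ}(\omega)<\infty$ for every $\omega\in\Omega$ is chosen (the same notation is used for the derivative and its representative). $\left\|\frac{dP}{dQ}\right\|_\infty$ denotes its essential supremum (with respect to $Q$), which could be $\infty$. The convention $\infty\cdot 0=0$ is used. Integrals are Lebesgue integrals; $\int \phi(X)\,dP$ and $\int\phi(X)\,dQ$ may take the value $+\infty$ (an integral is well defined if the positive part or the negative part of the integrand has finite integral). *)

(* Defs.v *)
From HB Require Import structures.
From mathcomp Require Import all_boot all_order all_algebra.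
From mathcomp Require Import interval_inference.
From mathcomp Require Import all_classical all_reals all_analysis.

Set Implicit Arguments.
Unset Strict Implicit.
Unset Printing Implicit Defensive.

Import Order.TTheory GRing.Theory Num.Theory.
Import numFieldNormedType.Exports.

Local Open Scope classical_set_scope.
Local Open Scope ring_scope.
Local Open Scope ereal_scope.
Local Open Scope convex_scope.
Local Open Scope charge_scope.

(* Strict counterpart of [convex_function] on [D]. *)
Definition strictly_convex_function (R : realType)
    (D : set (convex_lmodType R^o)) (f : convex_lmodType R^o -> R^o) : Prop :=
  forall t : {i01 R}, (0 < t%:num)%R -> (t%:num < 1)%R ->
    {in D &, forall x y : convex_lmodType R^o,
      x != y -> (f (x <| t |> y) < f x <| t |> f y)%R}.

(* The library's ['d P '/d Q] is one particular (extended-real-valued) version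
   of the Radon-Nikodym derivative, possibly negative on a Q-null set; [f] is
   a version with values in [0, +oo[ at every point. *)
Definition RN_representative d (T : measurableType d) (R : realType)
    (P Q : probability T R) (f : T -> R) : Prop :=
  [/\ measurable_fun setT f,
      forall x, (0 <= f x)%R &
      ae_eq Q setT (EFin \o f) ('d (charge_of_finite_measure P) '/d Q)].

(* The integral of [phi \o X] is extended-real-valued, the mean of the
   integrable function [X] is real. *)
Definition jensen_gap d (T : measurableType d) (R : realType)
    (mu : probability T R) (phi : R -> R) (X : T -> R) : \bar R :=
  \int[mu]_x (phi (X x))%:E - (phi (\int[mu]_x X x)%R)%:E.

Definition ae_constant d (T : measurableType d) (R : realType)
    (mu : probability T R) (X : T -> R) : Prop :=
  exists c : R, \forall x \ae mu, X x = c.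

(* Equality of measures is equality on the measurable sets: as functions on
   [set T], two equal measures may still differ off the sigma-algebra. *)
Definition same_measure d (T : measurableType d) (R : realType)
    (P Q : probability T R) : Prop :=
  forall A : set T, measurable A -> P A = Q A.

(* Main.v *)
(* Unless X is Q-a.e. constant, its Q-mean m is interior to I, so phi has a
   supporting line at m; subtracting it from phi gives g >= 0 on I with
   g(m) = 0 and changes neither Jensen gap. Writing f = dP/dQ and mP for the
   P-mean of X, the inequality becomes
     \int g(X) f dQ - g(mP) <= M * \int g(X) dQ,
   which holds because f <= M Q-a.e. and g(mP) >= 0. If phi is strictly convex,
   g vanishes only at m, so when M and \int g(X) dQ are finite, equality forces
   mP = m and, Q-a.e., f = M or X = m. *)
Require Import Defs.
From HB Require Import structures.
From mathcomp Require Import all_boot all_order all_algebra.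
From mathcomp Require Import interval_inference.
From mathcomp Require Import all_classical all_reals all_analysis.
From mathcomp Require Import ess_sup_inf.
From mathcomp Require Import measurable_realfun ring lra.

Set Implicit Arguments.
Unset Strict Implicit.
Unset Printing Implicit Defensive.

Import Order.TTheory GRing.Theory Num.Theory.
Import numFieldNormedType.Exports.

Local Open Scope classical_set_scope.
Local Open Scope ring_scope.
Local Open Scope ereal_scope.

(** * Convex functions on a set of reals: chord slopes, supporting lines, measurability *)

Section convexity.
Local Open Scope ring_scope.
Variables (R : realType) (I : set R) (phi : R -> R).

Lemma convex_function_le (t x y : R) :
  @convex_function R R^o I phi -> I x -> I y -> 0 <= t <= 1 ->
  phi (t * x + (1 - t) * y) <= t * phi x + (1 - t) * phi y.
Proof.
move=> cphi Ix Iy t01.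
by have := cphi (Itv01 (andP t01).1 (andP t01).2) x y (mem_set Ix) (mem_set Iy).
Qed.

Lemma strictly_convex_function_lt (t x y : R) :
  @strictly_convex_function R I phi -> I x -> I y -> x != y -> 0 < t < 1 ->
  phi (t * x + (1 - t) * y) < t * phi x + (1 - t) * phi y.
Proof.
move=> cphi Ix Iy xy /andP[t0 t1].
by have := cphi (Itv01 (ltW t0) (ltW t1)) t0 t1 x y (mem_set Ix) (mem_set Iy) xy.
Qed.

(** Writing [z] as the convex combination with weight [(y - z) / (y - x)] on [x], the convexity
    inequality multiplied by [y - x] is the slope inequality with its denominators cleared. *)
Lemma convex_function_slope (x z y : R) :
  @convex_function R R^o I phi -> I x -> I y -> x < z < y ->
  (phi z - phi x) / (z - x) <= (phi y - phi z) / (y - z).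
Proof.
move=> cphi Ix Iy /andP[xz zy].
have yx0 : 0 < y - x by lra.
pose t := (y - z) / (y - x).
have t01 : 0 <= t <= 1.
  by rewrite /t divr_ge0 ?ler_pdivrMr//; lra.
have := convex_function_le cphi Ix Iy t01.
have -> : t * x + (1 - t) * y = z by rewrite /t; field; lra.
rewrite /t -subr_ge0 => H.
rewrite ler_pdivrMr ?subr_gt0// mulrAC ler_pdivlMr ?subr_gt0//.
have : 0 <= ((y - z) / (y - x) * phi x + (1 - (y - z) / (y - x)) * phi y
   - phi z) * (y - x) by rewrite mulr_ge0// ltW.
suff -> : ((y - z) / (y - x) * phi x + (1 - (y - z) / (y - x)) * phi y
   - phi z) * (y - x) = (y - z) * phi x + (z - x) * phi y - (y - x) * phi z.
  by lra.
by field; lra.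
Qed.

(** The slope [s] is the supremum of the slopes of chords ending at [m] from the left. Each of these
    is at most every slope to the right of [m]; [a] makes the set of left slopes nonempty and [b]
    bounds it. *)
Lemma supporting_line (a m b : R) :
  @convex_function R R^o I phi -> I a -> I b -> a < m < b ->
  exists s : R, forall x, I x -> phi m + s * (x - m) <= phi x.
Proof.
move=> cphi Ia Ib /andP[am mb].
pose S := [set (phi m - phi x) / (m - x) | x in [set x | I x /\ x < m]].
have Sub y : I y -> m < y -> ubound S ((phi y - phi m) / (y - m)).
  move=> Iy my _ [x [Ix xm] <-].
  by apply: convex_function_slope => //; rewrite xm.
have supS : has_sup S.
  split; first by exists ((phi m - phi a) / (m - a)); exists a.
  by eexists; exact: Sub Ib mb.
exists (sup S) => x Ix; have [xm|mx|->] := ltgtP x m; last lra.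
- have : (phi m - phi x) / (m - x) <= sup S.
    by apply: sup_upper_bound => //; exists x.
  by rewrite ler_pdivrMr ?subr_gt0//; lra.
- have : sup S <= (phi x - phi m) / (x - m).
    by apply: ge_sup; [exact: supS.1|exact: Sub].
  by rewrite ler_pdivlMr ?subr_gt0//; lra.
Qed.

(** If the graph touched the line at some [x] other than [m], strict convexity would put it below
    the line at the midpoint of [x] and [m]. *)
Lemma strict_supporting_line (s m x : R) :
  @strictly_convex_function R I phi -> is_interval I -> I m ->
  (forall x, I x -> phi m + s * (x - m) <= phi x) ->
  I x -> x != m -> phi m + s * (x - m) < phi x.
Proof.
move=> cphi itvI Im supp Ix xm.
have h01 : 0 < (2^-1 : R) < 1 by lra.
have := strictly_convex_function_lt cphi Ix Im xm h01.
set z := _ * x + _.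
have Iz : I z.
  by case: (leP x m) => ?; [apply: (itvI x m)|apply: (itvI m x)];
    rewrite // /z; lra.
have := supp z Iz; rewrite {1}/z; lra.
Qed.

Lemma measurable_convex_comp d (T : measurableType d) (X : T -> R) :
  @convex_function R R^o I phi -> is_interval I -> range X `<=` I ->
  measurable_fun setT X -> measurable_fun setT (phi \o X).
Proof.
move=> cphi itvI XI mX.
apply: (measurability _ (RGenInftyO.measurableE R)) => // _ [_ [r ->] <-].
pose J := [set x | I x /\ phi x < r].
(* The sublevel sets of a convex function on an interval are intervals. *)
have -> : [set: T] `&` (phi \o X) @^-1` `]-oo, r[%classic = setT `&` X @^-1` J.
  rewrite !setTI preimage_itvNyo; apply/seteqP; split => w /=; last by case.
  by split => //; apply: XI; exists w.
apply: mX => //; apply: is_interval_measurable => x y [Ix rx] [Iy ry] z.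
move=> /andP[xz zy]; split.
  by apply: (itvI x y) => //; rewrite xz.
have [xy|yx] := ltP x y; last first.
  by have -> : z = x by lra.
have yx0 : 0 < y - x by lra.
pose t := (y - z) / (y - x).
have t01 : 0 <= t <= 1 by rewrite /t divr_ge0 ?ler_pdivrMr//; lra.
have := convex_function_le cphi Ix Iy t01.
have -> : t * x + (1 - t) * y = z by rewrite /t; field; lra.
move=> /le_lt_trans; apply.
(* The strict inequality comes from the term in [x], whose weight must be nonzero; for weight 0 it
   is the assumption on [y]. *)
have [t0|t0] := eqVneq t 0; first by rewrite t0; lra.
have tp : 0 < t by lra.
have : t * phi x < t * r by rewrite ltr_pM2l.
have : (1 - t) * phi y <= (1 - t) * r by apply: ler_wpM2l; [lra|exact: ltW].
lra.
Qed.
End convexity.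

(** * Integrals with possibly infinite value, means, and Jensen gaps *)

Section integration.
Context d (T : measurableType d) (R : realType).

Lemma ge0_integral_eq0_ae (mu : {measure set T -> \bar R}) (f : T -> R) :
  measurable_fun setT f -> (forall x, 0 <= f x)%R ->
  \int[mu]_x (f x)%:E = 0 -> \forall x \ae mu, f x = 0%R.
Proof.
move=> mf f0 If0.
have /(ae_eq_integral_abs mu measurableT) : measurable_fun setT (EFin \o f).
  exact/measurable_EFinP.
move=> [+ _]; under eq_integral do rewrite gee0_abs ?lee_fin//.
by move=> /(_ If0); apply: filterS => x /(_ I) [].
Qed.

(* [integralD] needs both functions to be integrable; here [g] may have an
   infinite integral. *)
Lemma ge0_integralDr (mu : {measure set T -> \bar R}) (g h : T -> R) :
  measurable_fun setT g -> (forall x, 0 <= g x)%R ->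
  mu.-integrable setT (EFin \o h) ->
  \int[mu]_x (g x + h x)%:E = \int[mu]_x (g x)%:E + \int[mu]_x (h x)%:E.
Proof.
move=> mg g0 ih; have mh := measurable_int _ ih.
have mG : measurable_fun setT (EFin \o g) by exact/measurable_EFinP.
have [gfin|] := boolP (\int[mu]_x (g x)%:E < +oo).
  have ig : mu.-integrable setT (EFin \o g).
    by apply/integrableP; split => //; under eq_integral do
      rewrite /= ger0_norm//.
  by under eq_integral do rewrite EFinD; rewrite integralD.
rewrite -leNgt leye_eq => /eqP goo.
have -> : \int[mu]_x (g x)%:E + \int[mu]_x (h x)%:E = +oo.
  by rewrite goo addye// gt_eqF// ltNye_eq (integrable_fin_num _ ih).
(* When [g] has infinite integral, so has [f]: the bound [f^\- <= h^\-] keeps the negative part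
   finite, while [g <= f^\+ + h^\-] forces the positive part to be infinite. *)
pose f x := (g x + h x)%:E.
have mf : measurable_fun setT f.
  by apply/measurable_EFinP/measurable_funD => //; exact/measurable_EFinP.
have hfin := integral_funeneg_lt_pinfty measurableT ih.
have fneg : \int[mu]_x f^\- x < +oo.
  apply: le_lt_trans hfin; apply: ge0_le_integral => //.
  - exact: measurable_funeneg.
  - exact: measurable_funeneg.
  - move=> x _; rewrite !funenegE /f/=.
    rewrite -!EFin_max lee_fin; have := g0 x => gx.
    by rewrite ge_max !le_max lexx !orbT andbT lerN2 lerDr gx.
have fpos : \int[mu]_x f^\+ x = +oo.
  apply/eqP; rewrite -leye_eq leNgt; apply/negP => fp.
  suff : \int[mu]_x (g x)%:E < +oo by rewrite goo.
  apply: (@le_lt_trans _ _ (\int[mu]_x (f^\+ x + (EFin \o h)^\- x))).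
    apply: ge0_le_integral => //.
    - by move=> x _; rewrite lee_fin.
    - by apply: emeasurable_funD;
        [exact: measurable_funepos|exact: measurable_funeneg].
    - move=> x _.
      rewrite funeposE funenegE /f/= -!EFin_max -EFinD lee_fin.
      have : (g x + h x <= Num.max (g x + h x) 0)%R by rewrite le_max lexx.
      have : (- h x <= Num.max (- h x) 0)%R by rewrite le_max lexx.
      lra.
  rewrite ge0_integralD//;
    [|exact: measurable_funepos|exact: measurable_funeneg].
  exact: lte_add_pinfty.
have fnegfin : \int[mu]_x f^\- x \is a fin_num.
  by rewrite ge0_fin_numE//; exact: integral_ge0.
rewrite -[LHS]/(\int[mu]_x f x) integralE fpos addye//.
by move: fnegfin; rewrite -fin_numN fin_numE => /andP[].
Qed.

Lemma EFin_Rintegral (mu : {measure set T -> \bar R}) D (f : T -> R) :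
  measurable D -> mu.-integrable D (EFin \o f) ->
  (\int[mu]_(x in D) f x)%R%:E = \int[mu]_(x in D) (f x)%:E.
Proof. by move=> mD fi; rewrite fineK//; exact: integrable_fin_num. Qed.

Lemma ae_dominates (mu nu : {measure set T -> \bar R}) (p : T -> Prop) :
  nu `<< mu -> (\forall x \ae mu, p x) -> \forall x \ae nu, p x.
Proof.
move=> /null_content_dominatesP numu [N [mN N0 pN]].
by exists N; split => //; exact: numu.
Qed.

Lemma ae_probability_ex (mu : probability T R) (p : T -> Prop) :
  (\forall x \ae mu, p x) -> exists x, p x.
Proof.
move=> mup; apply: contrapT => /forallNP np.
have : mu setT = 0.
  by apply/negligibleP => //; apply: negligibleS mup => x _; exact: np.
by rewrite probability_setT => /eqP; rewrite onee_eq0.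
Qed.

Section mean.
Variables (mu : probability T R) (X : T -> R).
Hypothesis iX : mu.-integrable setT (EFin \o X).
Local Notation m := (\int[mu]_x X x)%R.

Let mX : measurable_fun setT X.
Proof. exact/measurable_EFinP/measurable_int/iX. Qed.

Lemma Rintegral_ae_cst (c : R) : (\forall x \ae mu, X x = c) -> m = c.
Proof.
move=> Xc; apply: EFin_inj; rewrite EFin_Rintegral//.
rewrite (ae_eq_integral (cst c%:E))//.
- by rewrite integral_cst//= probability_setT mule1.
- exact/measurable_EFinP.
- by apply: filterS Xc => x -> _.
Qed.

Lemma integrable_affine (a b : R) :
  mu.-integrable setT (EFin \o (fun x => a + b * X x)%R).
Proof.
have := integrableD measurableT (finite_measure_integrable_cst mu a measurableT)
  (integrableZl measurableT b iX).
by apply: eq_integrable.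
Qed.

Lemma integral_affine (a b : R) :
  \int[mu]_x (a + b * X x)%:E = (a + b * m)%:E.
Proof.
under eq_integral do rewrite EFinD EFinM.
rewrite integralD//; last 2 first.
- exact: finite_measure_integrable_cst.
- exact: integrableZl.
by rewrite integral_cst//= probability_setT mule1 integralZl// -EFin_Rintegral.
Qed.

(** Otherwise [X - m] would be nonnegative with integral 0, hence zero a.e. With its mirror image
    for values above [m], this places the mean strictly between two values of [X]. *)
Lemma ex_lt_mean : ~ ae_constant mu X -> exists w, (X w < m)%R.
Proof.
move=> nX; apply: contrapT => /forallNP Xm; apply: nX; exists m.
have Xm0 x : (0 <= - m + 1 * X x)%R by have /negP := Xm x; rewrite -leNgt; lra.
have := @ge0_integral_eq0_ae mu _ _ Xm0; rewrite integral_affine.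
have -> : (- m + 1 * m = 0)%R by lra.
have mm : measurable_fun setT (fun x => - m + 1 * X x)%R.
  by apply/measurable_EFinP/measurable_int/integrable_affine.
by move=> /(_ mm erefl); apply: filterS => x; lra.
Qed.
End mean.

Lemma ex_gt_mean (mu : probability T R) (X : T -> R) :
  mu.-integrable setT (EFin \o X) ->
  ~ ae_constant mu X -> exists w, (\int[mu]_x X x < X w)%R.
Proof.
move=> iX nX; have iNX := integrable_affine iX 0 (-1).
have [|w] := ex_lt_mean iNX.
  by move=> [c cX]; apply: nX; exists (- c)%R; apply: filterS cX => x; lra.
have -> : (\int[mu]_x (0 + - 1 * X x) = 0 + -1 * \int[mu]_x X x)%R.
  by apply: EFin_inj; rewrite EFin_Rintegral// integral_affine.
by move=> ?; exists w; lra.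
Qed.

(** The interval may be unbounded or open, so bounds on [X] are replaced by actual values: the mean
    is itself a value of [X] or lies between two of them. *)
Lemma mean_is_interval (mu : probability T R) (X : T -> R) (I : set R) :
  mu.-integrable setT (EFin \o X) -> is_interval I -> range X `<=` I ->
  I (\int[mu]_x X x)%R.
Proof.
move=> iX itvI XI; have [[c Xc]|nX] := pselect (ae_constant mu X).
  rewrite (Rintegral_ae_cst iX Xc); have [w <-] := ae_probability_ex Xc.
  by apply: XI; exists w.
have [u um] := ex_lt_mean iX nX; have [v mv] := ex_gt_mean iX nX.
by apply: (itvI (X u) (X v));
  [apply: XI; exists u|apply: XI; exists v|rewrite !ltW].
Qed.

(** Affine functions commute with the mean, so their contributions cancel. Nonnegativity of [g]
    along [X] lets the integral be split even when it is infinite. *)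
Lemma jensen_gap_affine (mu : probability T R) (X : T -> R) (phi g : R -> R)
    (a b : R) :
  mu.-integrable setT (EFin \o X) -> measurable_fun setT (g \o X) ->
  (forall w, 0 <= g (X w))%R -> (forall x, phi x = g x + (a + b * x))%R ->
  jensen_gap mu phi X = jensen_gap mu g X.
Proof.
move=> iX mg g0 phiE; rewrite /jensen_gap phiE.
under eq_integral do rewrite phiE.
rewrite (ge0_integralDr mg g0 (integrable_affine iX a b)) integral_affine//.
rewrite -addeA -EFinB -EFinN; congr (_ + _%:E); lra.
Qed.

Lemma jensen_gap_ae_constant (mu : probability T R) (X : T -> R)
    (phi : R -> R) :
  mu.-integrable setT (EFin \o X) -> measurable_fun setT (phi \o X) ->
  ae_constant mu X -> jensen_gap mu phi X = 0.
Proof.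
move=> iX mphi [c Xc]; rewrite /jensen_gap (Rintegral_ae_cst iX Xc).
rewrite (ae_eq_integral (cst (phi c)%:E))//.
- by rewrite integral_cst//= probability_setT mule1 subee.
- exact/measurable_EFinP.
- by apply: filterS Xc => x -> _.
Qed.

End integration.

(** * Infinite gaps, and the mean as an average over a subset *)

Section gap.
Context d (T : measurableType d) (R : realType).
Variables (mu : probability T R) (phi : R -> R) (X : T -> R).

Lemma jensen_gap_eqy :
  jensen_gap mu phi X = +oo <-> \int[mu]_x (phi (X x))%:E = +oo.
Proof. by rewrite /jensen_gap; case: integral. Qed.

(** The complement of [A] contributes [m * (1 - mu A)] to the mean, which leaves [m * mu A] for the
    integral over [A]. *)
Lemma mean_over_set (A : set T) (m := (\int[mu]_x X x)%R) :
  mu.-integrable setT (EFin \o X) -> measurable A -> 0 < mu A ->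
  ae_eq mu (~` A) X (cst m) -> m = ((fine (mu A))^-1 * \int[mu]_(x in A) X x)%R.
Proof.
move=> iX mA A0 Xm; have mX := measurable_int _ iX.
have finA : mu A \is a fin_num by rewrite fin_num_measure.
have A1 : (0 < fine (mu A))%R by rewrite fine_gt0// A0 ltey_eq finA.
have mE : m = (\int[mu]_(x in A) X x + \int[mu]_(x in ~` A) X x)%R.
  rewrite /m -{1}(setUv A) Rintegral_setU ?setUv//; first exact: measurableC.
  by apply/disj_setPCl.
have XA : (\int[mu]_(x in ~` A) X x = m * (1 - fine (mu A)))%R.
  have -> : (1 - fine (mu A) = fine (mu (~` A)))%R.
    by rewrite probability_setC// fineB.
  rewrite -Rintegral_cst; last exact: measurableC.
  congr fine; apply: ae_eq_integral => //.
  - exact: measurableC.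
  - exact: measurable_funTS.
  - by apply: filterS Xm => x h /h /= ->.
have -> : (\int[mu]_(x in A) X x = m * fine (mu A))%R.
  by move: mE; rewrite XA; lra.
by rewrite mulrCA mulVf ?mulr1// gt_eqF.
Qed.

End gap.

(** * The chosen density and its essential supremum *)

Section radon_nikodym_representative.
Context d (T : measurableType d) (R : realType).
Variables (P Q : probability T R) (f : T -> R).
Hypothesis PQ : P `<< Q.
Hypothesis fRN : RN_representative P Q f.
Local Notation M := (ess_sup Q (EFin \o f)).

Let mf : measurable_fun setT (EFin \o f).
Proof. by apply/measurable_EFinP; case: fRN. Qed.

Let f0 x : (0 <= f x)%R.
Proof. by case: fRN. Qed.

(** The change of variables is known for the density [Radon_Nikodym_SigmaFinite.f]; that density and
    [f] both agree Q-a.e. with the charge derivative. *)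
Lemma RN_representative_integral (E : set T) (h : T -> \bar R) :
  measurable E -> measurable_fun E h -> (forall x, 0 <= h x) ->
  \int[P]_(x in E) h x = \int[Q]_(x in E) (h x * (f x)%:E).
Proof.
move=> mE mh h0.
rewrite -(Radon_Nikodym_SigmaFinite.change_of_variables PQ h0 mE mh).
have mg := measurable_int _ (Radon_Nikodym_SigmaFinite.f_integrable PQ).
apply: ge0_ae_eq_integral => //.
- by apply: emeasurable_funM => //; exact: measurable_funTS.
- by apply: emeasurable_funM => //; exact: measurable_funTS.
- by move=> x _; rewrite mule_ge0// Radon_Nikodym_SigmaFinite.f_ge0.
- by move=> x _; rewrite mule_ge0// lee_fin.
have [_ _ fE] := fRN.
apply: filterS2 fE (ae_eq_Radon_Nikodym_SigmaFinite PQ measurableT).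
by move=> x /= fE -> // _; rewrite fE.
Qed.

(** Otherwise [f] would vanish Q-a.e. and [P] would have total mass 0. Positivity ensures that [M]
    times an infinite gap is infinite, and that an infinite [M] times a positive gap is too. *)
Lemma ess_sup_RN_gt0 : 0 < M.
Proof.
rewrite ltNge; apply/negP => /ess_supP M0.
have : P setT = 0.
  rewrite -[LHS]mul1e -integral_cst// RN_representative_integral//.
  rewrite (ae_eq_integral (cst 0)) ?integral0//.
  - by apply: emeasurable_funM.
  - apply: filterS M0 => x /=; rewrite lee_fin => fx _.
    by rewrite mul1e; congr EFin; apply/eqP; rewrite eq_le fx f0.
by rewrite /= probability_setT => /eqP; rewrite onee_eq0.
Qed.

Lemma RN_integral_le_ess_sup (h : T -> R) :
  measurable_fun setT h -> (forall x, 0 <= h x)%R ->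
  \int[P]_x (h x)%:E <= M * \int[Q]_x (h x)%:E.
Proof.
move=> mh h0; have mH : measurable_fun setT (EFin \o h) by exact/measurable_EFinP.
rewrite RN_representative_integral//.
(* [M] may be [+oo] here: a nonnegative extended constant still comes out of the integral, with the
   product of infinity and 0 equal to 0. *)
have M0 := ltW ess_sup_RN_gt0.
rewrite -ge0_integralZl//; last by move=> x _; rewrite lee_fin.
apply: ae_ge0_le_integral => //.
- by move=> x _; rewrite mule_ge0// lee_fin.
- exact: emeasurable_funM.
- by move=> x _; rewrite mule_ge0// lee_fin.
- exact: measurable_funeM.
apply: filterS (ess_sup_ge Q (EFin \o f)) => x /= fM _.
by rewrite muleC lee_wpmul2r// lee_fin.
Qed.

(* With [k := (r - f)^+], the integrals of [h * f] and [h * k] add up to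
   [r * \int h]. *)
Lemma RN_integral_eq_ess_sup (h : T -> R) (r : R) :
  measurable_fun setT h -> (forall x, 0 <= h x)%R -> M = r%:E ->
  \int[Q]_x (h x)%:E < +oo ->
  \int[P]_x (h x)%:E = M * \int[Q]_x (h x)%:E <->
  \forall x \ae Q, h x = 0%R \/ f x = r.
Proof.
move=> mh h0 Mr hfin.
have mH : measurable_fun setT (EFin \o h) by exact/measurable_EFinP.
have r0 : (0 < r)%R by have := ess_sup_RN_gt0; rewrite Mr lte_fin.
have fr : \forall x \ae Q, (f x <= r)%R.
  have := ess_sup_ge Q (EFin \o f); rewrite Mr.
  by apply: filterS => x /=; rewrite lee_fin.
have H0 x : [set: T] x -> 0 <= (h x)%:E by rewrite lee_fin.
rewrite RN_representative_integral// Mr -ge0_integralZl ?lee_fin ?(ltW r0)//.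
have mf' : measurable_fun setT f by exact/measurable_EFinP.
pose k x := (h x * Num.max (r - f x) 0)%R.
have mk : measurable_fun setT k.
  by apply: measurable_funM => //; apply: measurable_maxr => //;
    exact: measurable_funB.
have k0 x : (0 <= k x)%R by rewrite mulr_ge0// le_max lexx orbT.
have mhf : measurable_fun setT (fun x => (h x)%:E * (f x)%:E).
  exact: emeasurable_funM.
split => [eqI|hf]; last first.
  apply: ae_eq_integral => //; first exact: measurable_funeM.
  by apply: filterS hf => x [->|->] _; rewrite ?mule0 ?mul0e// muleC.
have : \int[Q]_x (r%:E * (h x)%:E) =
    \int[Q]_x ((h x)%:E * (f x)%:E) + \int[Q]_x (k x)%:E.
  rewrite -ge0_integralD//; last 3 first.
  - by move=> x _; rewrite mule_ge0// lee_fin.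
  - by move=> x _; rewrite lee_fin.
  - exact/measurable_EFinP.
  apply: ae_eq_integral => //.
  - exact: measurable_funeM.
  - by apply: emeasurable_funD => //; exact/measurable_EFinP.
  apply: filterS fr => x fx _; rewrite -!EFinM -EFinD /k; congr EFin.
  by rewrite max_l; lra.
rewrite eqI.
(* Finiteness allows cancelling this integral from both sides, which leaves 0 for the integral of
   [k]. *)
have rfin : \int[Q]_x (r%:E * (h x)%:E) \is a fin_num.
  rewrite ge0_integralZl ?lee_fin ?(ltW r0)//.
  by rewrite fin_numM// ge0_fin_numE// integral_ge0.
move=> kI; have : \int[Q]_x (k x)%:E = 0.
  move: rfin kI; case: integral => // u _; case: integral => // v [uv].
  by congr EFin; lra.
move=> /(ge0_integral_eq0_ae mk k0).
apply: filterS2 fr => x fx /eqP; rewrite mulf_eq0 => /orP[/eqP ->|].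
  by left.
by rewrite max_l ?subr_ge0// subr_eq0 => /eqP ->; right.
Qed.

End radon_nikodym_representative.

(** * The inequality and its equality cases *)

Theorem theorem2p1 (d : measure_display) (Omega : measurableType d)
    (R : realType) (P Q : probability Omega R) (dPdQ : Omega -> R)
    (X : Omega -> R) (I : interval R) (phi : R -> R) :
  P `<< Q ->
  RN_representative P Q dPdQ ->
  P.-integrable setT (EFin \o X) ->
  Q.-integrable setT (EFin \o X) ->
  range X `<=` [set` I] ->
  @convex_function R R^o [set` I] phi ->
  let M : \bar R := ess_sup Q (EFin \o dPdQ) in
  let A : set Omega := [set w | (dPdQ w)%:E = M] in
  let lhs : \bar R := jensen_gap P phi X in
  let rhs : \bar R := M * jensen_gap Q phi X in
  lhs <= rhs /\
  (~ same_measure P Q ->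
    ((lhs = +oo /\ rhs = +oo <-> \int[P]_w (phi (X w))%:E = +oo) /\
     (\int[P]_w (phi (X w))%:E = +oo ->
        \int[Q]_w (phi (X w))%:E = +oo \/ M = +oo)) /\
    (strictly_convex_function [set` I] phi ->
      (lhs = 0 /\ rhs = 0 <-> ae_constant Q X) /\
      ((exists a : R, (0 < a)%R /\ lhs = a%:E /\ rhs = a%:E) <->
       (\int[Q]_w (phi (X w))%:E < +oo /\ M < +oo) /\
       (exists c : R,
          (ae_eq Q (~` A) X (cst c) /\ ~ ae_constant Q X) /\
          (0 < Q A /\ 0 < P A /\
           c = (\int[Q]_w X w)%R /\
           c = ((fine (Q A))^-1 * \int[Q]_(w in A) X w)%R /\
           c = (\int[P]_w X w)%R /\
           c = ((fine (P A))^-1 * \int[P]_(w in A) X w)%R))))).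
Proof.
move=> PQ fRN iXP iXQ XI cphi M A lhs rhs.
have itvI : is_interval [set` I] by exact: interval_is_interval.
have mX : measurable_fun setT X by exact/measurable_EFinP/measurable_int/iXQ.
have mphiX := measurable_convex_comp cphi itvI XI mX.
have M0 : 0 < M by exact: ess_sup_RN_gt0 PQ fRN.
have Mreal : M < +oo -> exists2 r, (0 < r)%R & M = r%:E.
  move=> Mlt; have finM : M \is a fin_num by rewrite ge0_fin_numE// ltW.
  by exists (fine M); rewrite ?fineK// fine_gt0// M0.
(* The inequality is a premise here because it is obtained separately for constant and for
   nonconstant [X]. *)
have infinite_case : lhs <= rhs ->
    (lhs = +oo /\ rhs = +oo <-> \int[P]_w (phi (X w))%:E = +oo) /\
    (\int[P]_w (phi (X w))%:E = +oo ->
       \int[Q]_w (phi (X w))%:E = +oo \/ M = +oo).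
  move=> lr; have rhsy : \int[P]_w (phi (X w))%:E = +oo -> rhs = +oo.
    by move=> /jensen_gap_eqy lhsy; move: lr; rewrite /lhs lhsy leye_eq => /eqP.
  split; first split => [[/jensen_gap_eqy//]|Py].
    by split; [exact/jensen_gap_eqy|exact: rhsy].
  move=> /rhsy; rewrite /rhs => rhsE; rewrite -jensen_gap_eqy.
  have [->|] := eqVneq M +oo; first by right.
  rewrite -ltey => /Mreal[r r0 Mr]; left; move: rhsE; rewrite Mr.
  case: jensen_gap => [s| |] //.
  by rewrite mulrNy gtr0_sg// mul1e.
(* For constant [X] the mean may be an endpoint of the interval, where a supporting line can fail to
   exist; here both gaps are simply 0. *)
have [cX|ncX] := pselect (ae_constant Q X).
  have lhs0 : lhs = 0.
    apply: jensen_gap_ae_constant => //; have [c Xc] := cX; exists c.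
    exact: ae_dominates PQ Xc.
  have rhs0 : rhs = 0 by rewrite /rhs jensen_gap_ae_constant// mule0.
  have lr : lhs <= rhs by rewrite lhs0 rhs0.
  split=> // _; split; first exact: infinite_case.
  move=> _; split=> //; split; last by move=> [_ [c [[_ /(_ cX)]]]].
  by move=> [a [a0 []]]; rewrite lhs0 => -[a_eq0]; move: a0; rewrite -a_eq0 ltxx.
pose m := (\int[Q]_w X w)%R; pose mP := (\int[P]_w X w)%R.
have Im : [set` I] m by exact: mean_is_interval.
have ImP : [set` I] mP by exact: mean_is_interval.
have [s phis] : exists s, forall x, [set` I] x ->
    (phi m + s * (x - m) <= phi x)%R.
  have [[u um] [v mv]] := (ex_lt_mean iXQ ncX, ex_gt_mean iXQ ncX).
  by apply: (@supporting_line _ _ _ (X u) _ (X v)) => //;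
    [apply: XI; exists u|apply: XI; exists v|apply/andP].
pose g x := (phi x - (phi m + s * (x - m)))%R.
have g0 x : [set` I] x -> (0 <= g x)%R by move=> /phis; rewrite subr_ge0.
have gm : g m = 0%R by rewrite /g; lra.
pose G := g \o X.
have G0 w : (0 <= G w)%R by apply: g0; apply: XI; exists w.
have mG : measurable_fun setT G.
  apply: measurable_funB => //; apply: measurable_funD => //.
  by apply: measurable_funM => //; exact: measurable_funB.
have phiE x : phi x = (g x + ((phi m - s * m) + s * x))%R by rewrite /g; lra.
have lhsE : lhs = \int[P]_w (G w)%:E - (g mP)%:E.
  by rewrite /lhs (jensen_gap_affine iXP mG G0 phiE).
have gapQE : jensen_gap Q phi X = \int[Q]_w (G w)%:E.
  by rewrite (jensen_gap_affine iXQ mG G0 phiE) /jensen_gap -/m gm sube0.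
have rhsE : rhs = M * \int[Q]_w (G w)%:E by rewrite /rhs gapQE.
have PQle : \int[P]_w (G w)%:E <= M * \int[Q]_w (G w)%:E.
  exact: RN_integral_le_ess_sup.
have lr : lhs <= rhs.
  by rewrite lhsE rhsE (le_trans _ PQle)// leeBlDr// leeDl// lee_fin g0.
split=> // _; split; first exact: infinite_case.
move=> scphi.
have g_gt0 x : [set` I] x -> g x = 0%R -> x = m.
  move=> Ix gx; apply/eqP; apply/negP => /negP xm.
  have := strict_supporting_line scphi itvI Im phis Ix xm.
  by rewrite -subr_gt0 -/(g x) gx ltxx.
have GXm w : G w = 0%R -> X w = m by apply: g_gt0; apply: XI; exists w.
(* An integral equal to 0 would give [G = 0], hence [X = m], Q-a.e. So [rhs] is positive, which
   rules out the common value 0 for nonconstant [X]. *)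
have iQ0 : 0 < \int[Q]_w (G w)%:E.
  have iQge0 : 0 <= \int[Q]_w (G w)%:E.
    by apply: integral_ge0 => w _; rewrite lee_fin.
  rewrite lt0e iQge0 andbT; apply/eqP => iG0; apply: ncX; exists m.
  by apply: filterS (ge0_integral_eq0_ae mG G0 iG0) => w /GXm.
have rhs_gt0 : 0 < rhs by rewrite rhsE mule_gt0.
have mA : measurable A.
  have mf : measurable_fun setT (EFin \o dPdQ).
    by case: fRN => ? _ _; exact/measurable_EFinP.
  by rewrite -[A]setTI; apply: emeasurable_fun_eq.
split.
  split=> [[_ r0]|/ncX//]; by move: rhs_gt0; rewrite r0 ltxx.
(* Condition a) concerns [phi], the equality criterion concerns [G]; the Q-gap is infinite exactly
   when either integral is. *)
have iQlt : \int[Q]_w (phi (X w))%:E < +oo <-> \int[Q]_w (G w)%:E < +oo.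
  rewrite !ltey; split => /eqP h; apply/eqP; move: h; rewrite -gapQE;
    by apply: contra_not => /jensen_gap_eqy.
split.
- move=> [a [a0 [lhsa rhsa]]].
  (* [rhs] is a product of two positive factors, so its finiteness makes each factor finite. *)
  have Mlt : M < +oo.
    by rewrite ltey; apply/eqP => My; move: rhsa; rewrite rhsE My gt0_mulye.
  have iQfin : \int[Q]_w (G w)%:E < +oo.
    by rewrite ltey; apply/eqP => iy; move: rhsa; rewrite rhsE iy gt0_muley.
  (* The integral is at most [a], and subtracting the nonnegative [g mP] from it gives exactly [a];
     both inequalities are therefore equalities. *)
  have [iPE gmP] : \int[P]_w (G w)%:E = a%:E /\ g mP = 0%R.
    move: PQle lhsa; rewrite -rhsE rhsa lhsE; have := g0 _ ImP.
    case: integral => // p gmP0; rewrite lee_fin => pa [pg].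
    by split; [congr EFin|]; lra.
  have mPm : mP = m by exact: g_gt0.
  have [r r0 Mr] := Mreal Mlt.
  have GA : \forall w \ae Q, G w = 0%R \/ dPdQ w = r.
    apply/(RN_integral_eq_ess_sup PQ fRN mG G0 Mr iQfin).
    by rewrite iPE -/M -rhsE rhsa.
  have XA : ae_eq Q (~` A) X (cst m).
    apply: filterS GA => w [/GXm//|fw] nA; exfalso; apply: nA.
    by rewrite /A /= fw Mr.
  have XPA : ae_eq P (~` A) X (cst mP).
    by rewrite mPm; apply: null_dominates_ae_eq PQ XA; exact: measurableC.
  (* If [A] were Q-null, [X = m] off [A] would make [X] constant Q-a.e. *)
  have QA0 : 0 < Q A.
    rewrite lt0e measure_ge0 andbT; apply/eqP => QA; apply: ncX; exists m.
    have nA : \forall w \ae Q, ~ A w by exists A; split => // w /contrapT.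
    by apply: filterS2 XA nA => w h /h.
  (* The density equals [M] on [A], so [P A = M * Q A]. *)
  have PA0 : 0 < P A.
    rewrite -[ltRHS]mul1e -integral_cst// (RN_representative_integral PQ fRN)//.
    rewrite (eq_integral (cst M)); last by move=> w /[!inE] Aw; rewrite mul1e.
    by rewrite integral_cst// mule_gt0.
  split; first by split => //; apply/iQlt.
  exists m; split=> //; do 2 split => //; split=> //.
  split; first exact: mean_over_set.
  by split=> //; rewrite -mPm; exact: mean_over_set.
(* Conversely, equal means give [g mP = g m = 0]. Off [A], Q-a.e. [X = c = m] and so [G = 0], while
   on [A] the density is [r]: the equality criterion applies, and [a] is the finite value of
   [rhs]. *)
- move=> [[/iQlt iQfin Mlt] [c [[XA _] [_ [_ [cQ [_ [cP _]]]]]]]].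
  have mPm : mP = m by rewrite /mP -cP cQ.
  have [r r0 Mr] := Mreal Mlt.
  have GA : \forall w \ae Q, G w = 0%R \/ dPdQ w = r.
    apply: filterS XA => w Xw; have [Aw|/Xw /= Xwc] := pselect (A w).
      by right; move: Aw; rewrite /A /= Mr => -[].
    by left; rewrite /G /= Xwc cQ.
  have lhsrhs : lhs = rhs.
    rewrite lhsE mPm gm sube0 rhsE.
    exact/(RN_integral_eq_ess_sup PQ fRN mG G0 Mr iQfin).
  have rhsfin : rhs \is a fin_num.
    by rewrite rhsE Mr fin_numM// ge0_fin_numE// ltW.
  exists (fine rhs); rewrite lhsrhs fineK//; split => //.
  by rewrite fine_gt0// rhs_gt0 ltey_eq rhsfin.
Qed.
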